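(* If $X$ is an S4 De Morgan spectral space, then the algebra of compact open sets $\mathcal{A}_0(X)=\langle\Omega(X);\cap,\cup,{}^*,\emptyset,X,\nabla_R\rangle$ is an S4 De Morgan algebra.
   Context: A De Morgan algebra is a bounded distributive lattice $\langle A;\wedge,\vee,0,1\rangle$ with a unary operation $-$ such that $a\leq b$ implies $-b\leq -a$, and $--a=a$. An S4 De Morgan algebra is a De Morgan algebra with a unary operation $\nabla$ such that $\nabla(a\vee b)=\nabla a\vee\nabla b$, $\nabla 0=0$, $a\leq\nabla a$, and $\nabla\nabla a\leq\nabla a$. For a topological space $X$, $\Omega(X)$ is the set of compact open subsets of $X$, and the specialization order is: $x\leqslant y$ iff every open set containing $x$ contains $y$. A spectral space is a compact, $T_0$, sober space $X$ such that $\Omega(X)$ is closed under finite intersections and is a basis for $X$ (sober: every completely prime filter of the lattice of open sets is the set of open neighbourhoods of some point). Given $g\colon X\to X$ and $R\subseteq X\times X$, for $U\subseteq X$ put $U^*=\{x\in X: g(x)\notin U\}$ and $\nabla_R U=R[U]=\{y\in X:\exists x\in U,\ xRy\}$. An S4 De Morgan spectral space is $\langle X;g,R,\tau\rangle$ such that: (1) $\langle X;\tau\rangle$ is a spectral space; (2) $g\colon X\to X$ is an order-inverting involution with respect to $\leqslant$, and $R$ is reflexive and transitive; (3) if $U\in\Omega(X)$ then $U^*,\nabla_RU\in\Omega(X)$; (4) if not $xRy$, there is $U\in\Omega(X)$ with $x\in U$ and $y\notin\nabla_RU$. In $\mathcal{A}_0(X)$, $\cap,\cup,{}^*,\emptyset,X,\nabla_R$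 interpret $\wedge,\vee,-,0,1,\nabla$. *)

(* Defs.v *)
From HB Require Import structures.
From mathcomp Require Import all_boot all_order.
From mathcomp Require Import boolp classical_sets functions filter topology.
Set Implicit Arguments.
Unset Strict Implicit.
Unset Printing Implicit Defensive.
Import Order.TTheory.
Local Open Scope classical_set_scope.

HB.mixin Record hasDeMorganNeg (d : Order.disp_t) (A : Type)
    of Order.TBDistrLattice d A := {
  neg : A -> A;
  neg_antitone : forall a b : A, (a <= b)%O -> (neg b <= neg a)%O;
  negK : forall a : A, neg (neg a) = a
}.

#[short(type="deMorganType")]
HB.structure Definition DeMorgan (d : Order.disp_t) :=
  { A of Order.TBDistrLattice d A & hasDeMorganNeg d A }.

HB.mixin Record hasS4Nabla (d : Order.disp_t) (A : Type)
    of DeMorgan d A := {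
  nabla : A -> A;
  nablaU : forall a b : A, nabla (a `|` b)%O = (nabla a `|` nabla b)%O;
  nabla0 : nabla \bot%O = \bot%O;
  le_nabla : forall a : A, (a <= nabla a)%O;
  nabla_nabla_le : forall a : A, (nabla (nabla a) <= nabla a)%O
}.

#[short(type="s4DeMorganType")]
HB.structure Definition S4DeMorgan (d : Order.disp_t) :=
  { A of DeMorgan d A & hasS4Nabla d A }.

Definition Omega (X : topologicalType) : set (set X) :=
  [set U | compact U /\ open U].

Definition specialization_le (X : topologicalType) (x y : X) : Prop :=
  forall U : set X, open U -> U x -> U y.

(* Completely prime filters of the lattice of open sets, given as families of
   open subsets.  Properness is the case [C = set0] of [cpf_bigcup]. *)
Record completely_prime_filter (X : topologicalType) (F : set (set X)) :
    Prop := {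
  cpf_open : forall U, F U -> open U;
  cpf_setT : F setT;
  cpf_upward : forall U V, open V -> U `<=` V -> F U -> F V;
  cpf_setI : setI_closed F;
  cpf_bigcup : forall C : set (set X), C `<=` open ->
    F (\bigcup_(U in C) U) -> exists2 U, C U & F U
}.

Definition sober (X : topologicalType) : Prop :=
  forall F : set (set X), completely_prime_filter F ->
    exists x : X, F = open_nbhs x.

(* [setI_closed] is binary; the empty intersection [setT] is in [Omega X] by
   [spectral_compact]. *)
Record spectral_space (X : topologicalType) : Prop := {
  spectral_compact : compact [set: X];
  spectral_T0 : kolmogorov_space X;
  spectral_sober : sober X;
  spectral_setI : setI_closed (@Omega X);
  spectral_basis : basis (@Omega X)
}.

Definition set_star (T : Type) (g : T -> T) (U : set T) : set T :=
  [set x | ~ U (g x)].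

Definition set_nabla (T : Type) (R : T -> T -> Prop) (U : set T) : set T :=
  [set y | exists2 x, U x & R x y].

Record s4_demorgan_spectral_space (X : topologicalType) (g : X -> X)
    (R : X -> X -> Prop) : Prop := {
  s4ds_spectral : spectral_space X;
  s4ds_antitone : forall x y : X,
    specialization_le x y -> specialization_le (g y) (g x);
  s4ds_involutive : involutive g;
  s4ds_refl : forall x : X, R x x;
  s4ds_trans : forall x y z : X, R x y -> R y z -> R x z;
  s4ds_star : forall U : set X, Omega U -> Omega (set_star g U);
  s4ds_nabla : forall U : set X, Omega U -> Omega (set_nabla R U);
  s4ds_separated : forall x y : X, ~ R x y ->
    exists U : set X, [/\ Omega U, U x & ~ set_nabla R U y]
}.

(* Main.v *)
Require Import Defs.
From HB Require Import structures.
From mathcomp Require Import all_boot all_order.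
From mathcomp Require Import boolp classical_sets functions filter topology.
Set Implicit Arguments.
Unset Strict Implicit.
Unset Printing Implicit Defensive.
Import Order.TTheory.
Local Open Scope classical_set_scope.

(** The compact open sets form a bounded sublattice of the powerset of [X]: finite unions are
    automatic, while intersections and the top come from spectrality ([OmegaI], [OmegaT]).
    Distributivity is thus inherited. Closure under star and nabla is assumed of the space, so only
    identities between sets remain. Star is the preimage under [g] of the complement, hence
    antitone, and [g] being an involution makes it one too ([set_starK]). Nabla is the direct image
    under [R], hence preserves finite unions ([set_nablaU], [set_nabla0]); reflexivity of [R] makes
    it inflationary and transitivity gives the S4 inequality. *)

Lemma OmegaI (X : topologicalType) (hX : spectral_space X) (U V : set X) :
  Omega U -> Omega V -> Omega (U `&` V).
Proof. by move=> oU oV; exact: spectral_setI. Qed.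

Lemma OmegaU (X : topologicalType) (U V : set X) :
  Omega U -> Omega V -> Omega (U `|` V).
Proof. by move=> [cU oU] [cV oV]; split; [exact: compactU | exact: openU]. Qed.

Lemma Omega0 (X : topologicalType) : Omega (set0 : set X).
Proof. by split; [exact: compact0 | exact: open0]. Qed.

Lemma OmegaT (X : topologicalType) (hX : spectral_space X) :
  Omega [set: X].
Proof. by split; [exact: spectral_compact | exact: openT]. Qed.

Lemma set_star_antitone (T : Type) (g : T -> T) (U V : set T) :
  U `<=` V -> set_star g V `<=` set_star g U.
Proof. by move=> UV x nVgx /UV. Qed.

(** The two complements cancel classically, leaving the preimage under [g] composed with itself,
    which is the identity. *)
Lemma set_starK (T : Type) (g : T -> T) :
  involutive g -> involutive (set_star g).
Proof.
by move=> gK U; apply/seteqP; split=> x; rewrite /set_star /= gK notK.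
Qed.

Lemma set_nablaU (T : Type) (R : T -> T -> Prop) (U V : set T) :
  set_nabla R (U `|` V) = set_nabla R U `|` set_nabla R V.
Proof.
apply/seteqP; split=> y; first by move=> [x [Ux|Vx] Rxy]; [left|right]; exists x.
by move=> [[x Ux Rxy]|[x Vx Rxy]]; exists x => //; [left|right].
Qed.

Lemma set_nabla0 (T : Type) (R : T -> T -> Prop) : set_nabla R set0 = set0.
Proof. by apply/seteqP; split=> // y []. Qed.

Lemma sub_set_nabla (T : Type) (R : T -> T -> Prop) (U : set T) :
  (forall x, R x x) -> U `<=` set_nabla R U.
Proof. by move=> Rxx x Ux; exists x. Qed.

Lemma set_nabla_nabla_sub (T : Type) (R : T -> T -> Prop) (U : set T) :
  (forall x y z, R x y -> R y z -> R x z) ->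
  set_nabla R (set_nabla R U) `<=` set_nabla R U.
Proof. by move=> Rtr z [y [x Ux Rxy] Ryz]; exists x => //; exact: Rtr Ryz. Qed.

(* A copy of [Omega X] indexed by the display and the space, so that the
   canonical structures below can be found from the carrier alone. *)
Definition omega_algebra (d : Order.disp_t) (X : topologicalType) (g : X -> X)
    (R : X -> X -> Prop) (hX : s4_demorgan_spectral_space g R) : Type :=
  set_type (@Omega X).

Section OmegaAlgebra.
Variables (d : Order.disp_t) (X : topologicalType) (g : X -> X).
Variables (R : X -> X -> Prop) (hX : s4_demorgan_spectral_space g R).

Local Notation A := (omega_algebra d hX).
Implicit Types U V W : A.

HB.instance Definition _ := Choice.copy A (set_type (@Omega X)).

Let sX : spectral_space X := s4ds_spectral hX.

Let carrier U : set X := set_val (U : set_type (@Omega X)).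

Let carrierP U : Omega (carrier U).
Proof. exact: set_valP. Qed.

(** Membership proofs are irrelevant, so every equation of the algebra reduces to an equation
    between subsets of [X]. *)
Let carrier_inj : injective carrier.
Proof. exact: val_inj. Qed.

Let mkA (U : set X) (oU : Omega U) : A := exist _ U (mem_set oU).

Definition omega_meet U V : A := mkA (OmegaI sX (carrierP U) (carrierP V)).
Definition omega_join U V : A := mkA (OmegaU (carrierP U) (carrierP V)).
Definition omega_bot : A := mkA (Omega0 X).
Definition omega_top : A := mkA (OmegaT sX).
Definition omega_neg U : A := mkA (s4ds_star hX (carrierP U)).
Definition omega_nabla U : A := mkA (s4ds_nabla hX (carrierP U)).
(** The order structures take boolean relations, hence the classical reflection of inclusion. *)
Definition omega_le U V : bool := `[< carrier U `<=` carrier V >].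
Definition omega_lt U V : bool := (V != U) && omega_le U V.

Let omega_le_def U V : omega_le U V = (omega_meet U V == U).
Proof.
apply/asboolP/eqP => [UV|<-]; last exact: subIsetr.
by apply: carrier_inj; exact/setIidPl.
Qed.

Let omega_meetC : commutative omega_meet.
Proof. by move=> U V; apply: carrier_inj; exact: setIC. Qed.

Let omega_joinC : commutative omega_join.
Proof. by move=> U V; apply: carrier_inj; exact: setUC. Qed.

Let omega_meetA : associative omega_meet.
Proof. by move=> U V W; apply: carrier_inj; exact: setIA. Qed.

Let omega_joinA : associative omega_join.
Proof. by move=> U V W; apply: carrier_inj; exact: setUA. Qed.

Let omega_joinKI V U : omega_meet U (omega_join U V) = U.
Proof. by apply: carrier_inj; exact/setIidPl/subsetUl. Qed.

Let omega_meetKU V U : omega_join U (omega_meet U V) = U.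
Proof. by apply: carrier_inj; apply/setUidPl; exact: subIsetl. Qed.

Let omega_meetUl : left_distributive omega_meet omega_join.
Proof. by move=> U V W; apply: carrier_inj; exact: setIUl. Qed.

Let omega_meetxx : idempotent_op omega_meet.
Proof. by move=> U; apply: carrier_inj; exact: setIid. Qed.

HB.instance Definition _ := Order.isMeetJoinDistrLattice.Build d A
  omega_le_def (fun U V => erefl (omega_lt U V)) omega_meetC omega_joinC
  omega_meetA omega_joinA omega_joinKI omega_meetKU omega_meetUl omega_meetxx.

(** The order of the lattice instance computes back to [omega_le], so the remaining inequalities can
    be proved as inclusions. *)
Let omega_leP U V : reflect (carrier U `<=` carrier V) (U <= V)%O.
Proof. exact: asboolP. Qed.

Let omega_le0x U : (omega_bot <= U)%O.
Proof. by apply/omega_leP; exact: sub0set. Qed.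

Let omega_lex1 U : (U <= omega_top)%O.
Proof. by apply/omega_leP; exact: subsetT. Qed.

HB.instance Definition _ := Order.hasBottom.Build d A omega_le0x.
HB.instance Definition _ := Order.hasTop.Build d A omega_lex1.

Let omega_neg_antitone U V : (U <= V)%O -> (omega_neg V <= omega_neg U)%O.
Proof. by move=> /omega_leP UV; apply/omega_leP; exact: set_star_antitone. Qed.

Let omega_negK : involutive omega_neg.
Proof.
by move=> U; apply: carrier_inj; apply: set_starK; exact: s4ds_involutive hX.
Qed.

HB.instance Definition _ :=
  hasDeMorganNeg.Build d A omega_neg_antitone omega_negK.

Let omega_nablaU U V :
  omega_nabla (U `|` V)%O = (omega_nabla U `|` omega_nabla V)%O.
Proof. by apply: carrier_inj; exact: set_nablaU. Qed.

Let omega_nabla0 : omega_nabla \bot%O = \bot%O.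
Proof. by apply: carrier_inj; exact: set_nabla0. Qed.

Let omega_le_nabla U : (U <= omega_nabla U)%O.
Proof. by apply/omega_leP; apply: sub_set_nabla; exact: s4ds_refl hX. Qed.

Let omega_nabla_nabla_le U : (omega_nabla (omega_nabla U) <= omega_nabla U)%O.
Proof.
by apply/omega_leP; apply: set_nabla_nabla_sub; exact: s4ds_trans hX.
Qed.

HB.instance Definition _ := hasS4Nabla.Build d A
  omega_nablaU omega_nabla0 omega_le_nabla omega_nabla_nabla_le.

End OmegaAlgebra.

(* The algebra is an element [c] of the class of S4 De Morgan algebras on the
   carrier [Omega X]: closure of [Omega X] under the set operations and all the
   axioms are part of the claim.  Its order is inclusion, being determined by
   the meet. *)
Theorem lemma3p12 (d : Order.disp_t) (X : topologicalType) (g : X -> X)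
    (R : X -> X -> Prop) (hX : s4_demorgan_spectral_space g R) :
  exists c : S4DeMorgan d (set_type (@Omega X)),
    let A : s4DeMorganType d := S4DeMorgan.Pack c in
    (forall U V : A, set_val (U `&` V)%O = set_val U `&` set_val V) /\
    (forall U V : A, set_val (U `|` V)%O = set_val U `|` set_val V) /\
    (forall U : A, set_val (neg U) = set_star g (set_val U)) /\
    set_val (\bot%O : A) = set0 /\
    set_val (\top%O : A) = setT /\
    (forall U : A, set_val (nabla U) = set_nabla R (set_val U)).
Proof.
(* [omega_algebra d hX] unfolds to [set_type (@Omega X)], so its class has the required type, and
   the six equations hold by computation. *)
by exists (S4DeMorgan.class (omega_algebra d hX)).
Qed.
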